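(* In the setting of the context (no gate noise), fix $\theta^t\in\mathbb{R}^D$ and let $\hat g_t$ be the parameter-shift gradient estimator at $\theta^t$ based on $N_m$ measurements per shifted circuit; it is unbiased, and one writes $\hat g_t=g_t+\xi_t$ with $g_t=\nabla L(\theta^t)$. Then its variance satisfies $$\mathrm{var}(\xi_t)=\mathbb{E}\|\hat g_t-g_t\|^2\le\frac{\nu N_hD\operatorname{Tr}(H^2)}{2N_m},$$ where $\nu\in[0,0.25]$ is $$\nu=\max_{\theta\in\mathbb{R}^D}\max_{y\in\{1,\dots,N_h\}}p(y|\theta)\bigl(1-p(y|\theta)\bigr).$$
   Context: Fix $n$ qubits and $D\ge1$ parameters $\theta=(\theta_1,\dots,\theta_D)\in\mathbb{R}^D$. The circuit is $U(\theta)=\prod_{d=1}^DU_d(\theta_d)V_d$, where $U_d(\theta_d)=\exp(-i\frac{\theta_d}2G_d)$, $G_d\in\{I,X,Y,Z\}^{\otimes n}$ is a Pauli string, and $V_d$ is a fixed unitary; $|\Psi(\theta)\rangle=U(\theta)|0\rangle$, $\Psi(\theta)=|\Psi(\theta)\rangle\langle\Psi(\theta)|$. The observable $H=\sum_{y=1}^{N_h}h_y\Pi_y$ is a Hermitian matrix with $N_h\le2^n$ distinct eigenvalues $h_y$ and eigenprojections $\Pi_y$; the loss is $L(\theta)=\operatorname{Tr}(H\Psi(\theta))$, and $p(y|\theta)=\operatorname{Tr}(\Pi_y\Psi(\theta))$. $\widehat{\langle H\rangle}_{|\Psi(\theta)\rangle}$ denotes the average of $N_m$ i.i.d. measurement outcomes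 of $H$ in state $|\Psi(\theta)\rangle$ (outcome $h_y$ with probability $p(y|\theta)$). With $e_d$ the $d$-th standard basis vector, $[\hat g_t]_d=\frac12\bigl(\widehat{\langle H\rangle}_{|\Psi(\theta^t+\frac\pi2e_d)\rangle}-\widehat{\langle H\rangle}_{|\Psi(\theta^t-\frac\pi2e_d)\rangle}\bigr)$ for $d=1,\dots,D$, with mutually independent empirical averages; the expectation is over these $2DN_m$ measurements. *)

(* Defs.v *)
(* MathComp + MathComp-Analysis; complex numbers are R[i] for R : realType. *)
From HB Require Import structures.
From mathcomp Require Import all_boot all_order all_algebra spectral.
From mathcomp Require Import complex mxtens.
From mathcomp Require Import all_classical all_reals all_analysis.

Set Implicit Arguments.
Unset Strict Implicit.
Unset Printing Implicit Defensive.

Import Order.TTheory GRing.Theory Num.Theory.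
Import numFieldNormedType.Exports.

Local Open Scope classical_set_scope.
Local Open Scope complex_scope.
Local Open Scope ring_scope.

(* The topology on R[i] is carried by the alias R[i]^o, whence the cast. *)
Definition mxexp (R : realType) n (A : 'M[R[i]]_n) : 'M[R[i]]_n :=
  limn (series (fun k : nat => (k`!%:R)^-1 *: A ^+ k : 'M[R[i]^o]_n)).

Inductive pauli := PauliI | PauliX | PauliY | PauliZ.

Definition pauli_mx (R : realType) (s : pauli) : 'M[R[i]]_2 :=
  \matrix_(i, j)
    match s with
    | PauliI => if i == j then 1 else 0
    | PauliX => if i == j then 0 else 1
    | PauliY => if i == j then 0 else if i == 0 then - 'i%C else 'i%C
    | PauliZ => if i != j then 0 else if i == 0 then 1 else - 1
    end.

Fixpoint pauli_string (R : realType) n : n.-tuple pauli -> 'M[R[i]]_(2 ^ n) :=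
  if n is k.+1 then
    fun s => castmx (esym (expnS 2 k), esym (expnS 2 k))
      (pauli_mx R (thead s) *t pauli_string R (behead_tuple s))
  else fun=> 1%:M.

Section Circuit.
Variables (R : realType) (n D : nat).
Variables (G : 'I_D -> n.-tuple pauli) (V : 'I_D -> 'M[R[i]]_(2 ^ n)).
Implicit Types theta : 'rV[R]_D.

Definition rotation (s : n.-tuple pauli) (t : R) : 'M[R[i]]_(2 ^ n) :=
  mxexp (- ('i%C * (t / 2)%:C) *: pauli_string R s).

(* The factors are multiplied from left to right in increasing order of d. *)
Definition circuit theta : 'M[R[i]]_(2 ^ n) :=
  \prod_(d < D) (rotation (G d) (theta 0 d) *m V d).

Definition ket0 : 'cV[R[i]]_(2 ^ n) := \col_i (val i == 0%N)%:R.

Definition ket theta : 'cV[R[i]]_(2 ^ n) := circuit theta *m ket0.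

Definition density theta : 'M[R[i]]_(2 ^ n) :=
  ket theta *m (ket theta)^t*%sesqui.

(* For Hermitian A this trace is real. *)
Definition observable_mean (A : 'M[R[i]]_(2 ^ n)) theta : R :=
  complex.Re (\tr (A *m density theta)).

End Circuit.

(* P is the orthogonal projection onto the eigenspace {v | A v = a v}. *)
Definition is_eigenprojection (R : realType) n (A : 'M[R[i]]_n) (a : R)
    (P : 'M[R[i]]_n) : Prop :=
  [/\ P \is hermsymmx, P *m P = P &
      forall v : 'cV[R[i]]_n, P *m v = v <-> A *m v = a%:C *: v].

Definition is_spectral_decomposition (R : realType) n (H : 'M[R[i]]_n) Nh
    (h : 'I_Nh -> R) (Pi : 'I_Nh -> 'M[R[i]]_n) : Prop :=
  [/\ injective h,
      forall a : R[i], eigenvalue H a <-> exists y, a = (h y)%:C,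
      forall y, is_eigenprojection H (h y) (Pi y) &
      H = \sum_(y < Nh) (h y)%:C *: Pi y].

Definition is_maximum (R : realType) (A : set R) (m : R) : Prop :=
  A m /\ ubound A m.

Definition gradient (R : realType) D (f : 'rV[R]_D -> R) (x : 'rV[R]_D) :
    'rV[R]_D :=
  \row_d 'D_(delta_mx 0 d) f x.

(* `|v| is the sup norm on matrices, so the Euclidean norm is spelled out. *)
Definition sqnorm2 (R : realType) D (v : 'rV[R]_D) : R :=
  \sum_(d < D) v 0 d ^+ 2.

(* true is the shift by + pi / 2 and false the shift by - pi / 2. *)
Definition shift_param (R : realType) D (theta : 'rV[R]_D) (s : bool)
    (d : 'I_D) : 'rV[R]_D :=
  if s then theta + (pi / 2) *: delta_mx 0 d
  else theta - (pi / 2) *: delta_mx 0 d.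

Section Sampling.
Context (disp : measure_display) (T : measurableType disp) (R : realType).
Variable P : probability T R.

Definition mutually_independent (I : finType) (X : I -> T -> R) : Prop :=
  forall (J : {set I}) (B : I -> set R), (forall i, measurable (B i)) ->
    P (\bigcap_(i in [set` J]) (X i @^-1` B i)) =
    (\prod_(i in J) P (X i @^-1` B i))%E.

Definition vmean D (X : T -> 'rV[R]_D) : 'rV[R]_D :=
  \row_d fine (expectation P (fun w => X w 0 d)).

Definition vvariance D (X : T -> 'rV[R]_D) : \bar R :=
  expectation P (fun w => sqnorm2 (X w - vmean X)).

Definition empirical_mean m (X : 'I_m -> {RV P >-> R}) (w : T) : R :=
  (\sum_(k < m) X k w) / m%:R.

Definition gradient_estimator D m
    (M : bool -> 'I_D -> 'I_m -> {RV P >-> R}) (w : T) : 'rV[R]_D :=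
  \row_d (2^-1 * (empirical_mean (M true d) w - empirical_mean (M false d) w)).

End Sampling.

(* Main.v *)
(* Each Pauli string squares to the identity, so exp(-i t G / 2) is
   cos(t/2) - i sin(t/2) G and the loss is a + b cos t + c sin t along each
   coordinate: this gives the parameter-shift rule, hence unbiasedness, and
   reduces the maximum defining nu to a continuous function on a compact box.
   The averages being independent, the variance of each gradient coordinate is
   (Var+ + Var-) / (4 Nm), where Var is the variance of one outcome, namely
   sum_yz h_y h_z (p_y [y = z] - p_y p_z).  Every coefficient here is at most nu
   in absolute value, because p_z <= 1 - p_y for z <> y, so Var is at most
   nu (sum_y |h_y|)^2 <= nu Nh sum_y h_y^2 <= nu Nh Tr(H^2). *)
Require Import Defs.
From HB Require Import structures.
From mathcomp Require Import all_boot all_order all_algebra spectral.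
From mathcomp Require Import complex mxtens.
From mathcomp Require Import all_classical all_reals all_analysis.
From mathcomp Require Import measurable_realfun ring lra.

Set Implicit Arguments.
Unset Strict Implicit.
Unset Printing Implicit Defensive.

Import Order.TTheory GRing.Theory Num.Theory.
Import numFieldNormedType.Exports.

Local Open Scope classical_set_scope.
Local Open Scope complex_scope.
Local Open Scope ring_scope.

(** * Pauli rotations *)

Lemma cvg_series_scale2 (K : numFieldType) (V : normedModType K) (a b : K^nat)
    (A B : V) (la lb : K) :
  series a @ \oo --> la -> series b @ \oo --> lb ->
  series (fun k => a k *: A + b k *: B) @ \oo --> la *: A + lb *: B.
Proof.
move=> ha hb.
have -> : series (fun k => a k *: A + b k *: B) =
    (fun k => series a k *: A + series b k *: B).
  by apply/funext => k; rewrite /series /= big_split /= !scaler_suml.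
by apply: cvgD; exact: cvgZr_tmp.
Qed.

Lemma limn_series_scale2 (K : numFieldType) n (a b : K^nat)
    (A B : 'M[K]_n) (la lb : K) :
  series a @ \oo --> la -> series b @ \oo --> lb ->
  limn (series (fun k => a k *: A + b k *: B : 'M[K]_n)) = la *: A + lb *: B.
Proof.
move=> ha hb; apply: cvg_lim; first exact: norm_hausdorff.
exact: cvg_series_scale2.
Qed.

(** The complex modulus of a real number is its absolute value. A tolerance [e] that is positive in
    the order of [R[i]] has zero imaginary part, so [Re e] is a legitimate real tolerance. *)
Lemma cvg_real_complex (R : realType) (u : R^nat) (l : R) :
  u @ \oo --> l -> (fun k => (u k)%:C : R[i]^o) @ \oo --> (l%:C : R[i]^o).
Proof.
move=> /cvgrPdist_lt ul; apply/cvgrPdist_lt => e e0.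
have := e0; rewrite ltcE /= => /andP[/eqP Ie Re0].
have := ul _ Re0.
apply: filterS => k.
rewrite -rmorphB normc_def /= expr0n addr0 sqrtr_sqr ltcE /= => ->.
by rewrite Ie eqxx.
Qed.

(** The powers of an involution alternate between [1] and [A], so the exponential series splits into
    the cosine series times [1] and the sine series times [-i A]. *)
Lemma mxexp_involutive (R : realType) n (A : 'M[R[i]]_n) (x : R) :
  A *m A = 1%:M ->
  mxexp (- ('i%C * x%:C) *: A) =
  (cos x)%:C *: 1%:M + (- ('i%C * (sin x)%:C)) *: A.
Proof.
move=> AA; rewrite /mxexp.
pose a : (R[i]^o)^nat := fun k => (cos_coeff x k)%:C.
pose b : (R[i]^o)^nat := fun k => - ('i%C * (sin_coeff x k)%:C).
rewrite (_ : (fun k : nat => _) =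
    (fun k => a k *: (1%:M : 'M[R[i]^o]_n) + b k *: (A : 'M[R[i]^o]_n))); last first.
  apply/funext => k.
  (* Separating parities gives exactly the signs and exponents of [cos_coeff] and [sin_coeff]; the
     factorials are handled afterwards. *)
  have -> : (- ('i%C * x%:C) *: A) ^+ k =
      (if odd k then - ('i%C * ((-1) ^+ k.-1./2 * x ^+ k)%:C) *: A
       else ((-1) ^+ k./2 * x ^+ k)%:C *: 1%:M).
    elim: k => [|k IH]; first by rewrite !expr0 mulr1 scale1r.
    rewrite exprS {}IH /=; case/boolP: (odd k) => [ok|ek].
      rewrite /= -[_ * _]/(_ *m _) -scalemxAl -scalemxAr scalerA AA; congr (_ *: _).
      have -> : uphalf k = k.-1./2.+1 by case: k ok.
      rewrite mulrNN mulrACA -expr2 sqr_i !exprS -rmorphM.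
      have -> : -1 = (-1 : R)%:C by rewrite rmorphN rmorph1.
      rewrite -rmorphM; apply: (congr1 (real_complex R)); ring.
    rewrite /= -[_ * _]/(_ *m _) -scalemxAl -scalemxAr scalerA mulmx1; congr (_ *: _).
    rewrite exprS mulNr -mulrA -rmorphM; congr (- (_ * _)).
    apply: (congr1 (real_complex R)); ring.
  rewrite /a /b /cos_coeff /sin_coeff /=.
  case: (odd k) => /=;
    rewrite ?(mul0r, mul1r, scale0r, rmorph0, mulr0, oppr0, add0r, addr0) scalerA;
    congr (_ *: _).
    by rewrite [in RHS]rmorphM fmorphV rmorph_nat /=; ring.
  by rewrite [in RHS]rmorphM fmorphV rmorph_nat /= mulrC.
have hc : series a @ \oo --> ((cos x)%:C : R[i]^o).
  have -> : series a = fun k => (series (cos_coeff x) k)%:C.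
    by apply/funext => k; rewrite /series /= rmorph_sum.
  apply: cvg_real_complex; rewrite unlock; exact: is_cvg_series_cos_coeff.
have hs : series b @ \oo --> (- ('i%C * (sin x)%:C) : R[i]^o).
  have -> : series b = fun k => - 'i%C * (series (sin_coeff x) k)%:C.
    apply/funext => k; rewrite /series /= rmorph_sum /= mulr_sumr.
    by apply: eq_bigr => j _; rewrite mulNr.
  rewrite -mulNr; apply: cvgMl_tmp.
  apply: cvg_real_complex; rewrite unlock; exact: is_cvg_series_sin_coeff.
exact: (@limn_series_scale2 (R[i] : numFieldType) _ _ _ _ _ _ _ hc hs).
Qed.

Lemma pauli_mx_mul (R : realType) (s : pauli) :
  pauli_mx R s *m pauli_mx R s = 1%:M.
Proof.
apply/matrixP => i j; rewrite !mxE !big_ord_recl big_ord0 !mxE.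
by case: s; case: i => [[|[|//]] ?]; case: j => [[|[|//]] ?];
  rewrite /= ?(mulr0, mul0r, mulr1, mul1r, addr0, add0r, mulNr, mulrN, opprK) //
    -expr2 sqr_i opprK.
Qed.

Lemma pauli_mx_adj (R : realType) (s : pauli) :
  ((pauli_mx R s) ^t*)%sesqui = pauli_mx R s.
Proof.
apply/matrixP => i j; rewrite !mxE /=.
case: s; case: i => [[|[|//]] ?]; case: j => [[|[|//]] ?];
  rewrite /= ?rmorphN ?rmorph0 ?rmorph1 //.
all: by rewrite /Num.conj /=; simpc.
Qed.

Lemma tensmx11 (K : comPzRingType) m n : (1%:M : 'M[K]_m) *t (1%:M : 'M[K]_n) = 1%:M.
Proof.
apply/matrixP => i j.
case: (mxtens_indexP i) => i1 i2; case: (mxtens_indexP j) => j1 j2.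
by rewrite tensmxE !mxE (can_eq (@mxtens_indexK _ _)) -mulnb natrM.
Qed.

Lemma castmx_mul_square (K : pzRingType) m n (e : m = n) (A B : 'M[K]_m) :
  castmx (e, e) A *m castmx (e, e) B = castmx (e, e) (A *m B).
Proof. by case: n / e. Qed.

Lemma castmx_1 (K : pzRingType) m n (e : m = n) :
  castmx (e, e) (1%:M : 'M[K]_m) = 1%:M.
Proof. by case: n / e. Qed.

Lemma pauli_string_mul (R : realType) n (s : n.-tuple pauli) :
  pauli_string R s *m pauli_string R s = 1%:M.
Proof.
elim: n s => [|n IH] s; first by rewrite /= mulmx1.
by rewrite /= castmx_mul_square tensmx_mul IH pauli_mx_mul tensmx11 castmx_1.
Qed.

Lemma pauli_string_adj (R : realType) n (s : n.-tuple pauli) :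
  ((pauli_string R s) ^t*)%sesqui = pauli_string R s.
Proof.
elim: n s => [|n IH] s; first by rewrite /= trmx1 map_mx1.
by rewrite /= trmx_cast map_castmx /= trmx_tens map_mxT IH pauli_mx_adj.
Qed.

(** * Unitarity and the spectral decomposition *)

Lemma conjC_real_complex (R : realType) (x : R) : Num.conj (x%:C) = x%:C.
Proof. by rewrite /Num.conj /= oppr0. Qed.

Lemma Re_trace_sum (R : rcfType) n (I : Type) (r : seq I) (P : pred I)
    (F : I -> 'M[R[i]]_n) :
  complex.Re (\tr (\sum_(i <- r | P i) F i)) =
  \sum_(i <- r | P i) complex.Re (\tr (F i)).
Proof.
apply: (big_morph (fun A : 'M[R[i]]_n => complex.Re (\tr A))) => [A B|].
  by rewrite mxtraceD; case: (\tr A) (\tr B) => [a b] [c d].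
by rewrite mxtrace0.
Qed.

Section Rotation.
Variables (R : realType) (n : nat).

Lemma rotationE (s : n.-tuple pauli) (t : R) :
  rotation s t = (cos (t / 2))%:C *: 1%:M
                 + (- ('i%C * (sin (t / 2))%:C)) *: pauli_string R s.
Proof. exact/mxexp_involutive/pauli_string_mul. Qed.

(** As [G] is Hermitian with square 1, the product (c - i d G)(c + i d G) is c^2 + d^2 = 1; the two
    terms linear in [G] cancel. *)
Lemma rotation_unitary (s : n.-tuple pauli) (t : R) :
  rotation s t \is unitarymx.
Proof.
apply/unitarymxP; rewrite rotationE; set c := cos _; set d := sin _.
have cd : c ^+ 2 + d ^+ 2 = 1 by exact: cos2Dsin2.
rewrite linearD /= map_mxD !linearZ /= !map_mxZ trmx1 map_mx1 pauli_string_adj /=.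
have dd : Num.conj (- ('i%C * d%:C)) = 'i%C * d%:C.
  by rewrite /Num.conj /=; simpc.
rewrite conjC_real_complex dd mulmxDl !mulmxDr -!scalemxAl -!scalemxAr.
rewrite !scalerA !mulmx1 !mul1mx.
rewrite pauli_string_mul [X in _ + X]addrC addrACA -!scalerDl.
rewrite mulNr mulrACA -!expr2 sqr_i mulN1r opprK -!rmorphXn -rmorphD cd.
rewrite [X in X *: pauli_string _ _](_ : _ = 0) ?scale0r ?addr0 ?scale1r //.
by rewrite mulrC mulNr subrr.
Qed.

Lemma circuit_unitary D (G : 'I_D -> n.-tuple pauli) V (theta : 'rV[R]_D) :
  (forall d, V d \is unitarymx) -> circuit G V theta \is unitarymx.
Proof.
move=> Vu; rewrite /circuit; elim/big_ind: _ => [||d _].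
- by apply/unitarymxP; rewrite trmx1 map_mx1 mulmx1.
- by move=> A B; exact: mul_unitarymx.
- exact/mul_unitarymx/Vu/rotation_unitary.
Qed.

(** By cyclicity the trace is the squared norm of U|0>, which unitarity reduces to that of |0>. *)
Lemma trace_density D (G : 'I_D -> n.-tuple pauli) V (theta : 'rV[R]_D) :
  (forall d, V d \is unitarymx) -> \tr (density G V theta) = 1.
Proof.
move=> Vu; rewrite /density mxtrace_mulC /ket trmx_mul map_mxM.
have Uu := circuit_unitary G theta Vu.
have UU : ((circuit G V theta) ^t*)%sesqui *m circuit G V theta = 1%:M.
  by rewrite -[LHS]mul1mx mulmxA mulmxKtV.
rewrite mulmxA -[X in \tr (X *m _)]mulmxA UU mulmx1 /mxtrace big_ord1 !mxE.
have n0 : (0 < 2 ^ n)%N by rewrite expn_gt0.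
rewrite (bigD1 (Ordinal n0)) //= big1 ?addr0.
  by rewrite !mxE /= rmorph1 mulr1.
by move=> i /negPf i0; rewrite !mxE /= -(inj_eq val_inj) /= in i0 *; rewrite i0 mulr0.
Qed.

End Rotation.

(** Take a rank factorization A = C R. Idempotence reads C (R C) R = C R, and cancelling the
    full-rank factors gives R C = 1 in dimension rank A; then Tr(C R) = Tr(R C). *)
Lemma mxtrace_idempotent (K : fieldType) n (A : 'M[K]_n) :
  A *m A = A -> \tr A = (\rank A)%:R.
Proof.
move=> AA; have CR := mulmx_base A.
have RC : row_base A *m col_base A = 1%:M.
  have := row_base_free A; have := col_base_full A.
  move: (col_base A) (row_base A) CR => C R CR.
  move=> /row_full_inj Cinj /row_free_inj Rinj.
  apply: Cinj; apply: Rinj => /=.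
  by rewrite mulmx1 mulmxA -mulmxA CR AA.
by rewrite -{1}CR mxtrace_mulC RC mxtrace1.
Qed.

Section Spectral.
Variables (R : realType) (n : nat).
Implicit Types (A P : 'M[R[i]]_n).

Lemma mulmx_cV_inj (K : pzRingType) m p (A B : 'M[K]_(m, p)) :
  (forall v : 'cV_p, A *m v = B *m v) -> A = B.
Proof.
move=> AB; apply/matrixP => i j.
by have /matrixP /(_ i 0) := AB (delta_mx j 0); rewrite -!colE !mxE.
Qed.

Lemma hermsymmx_adj A : A \is hermsymmx -> (A ^t*)%sesqui = A.
Proof. by move=> /is_hermitianmxP {2}->; rewrite expr0 scale1r. Qed.

(** [eigenvalue] speaks of row eigenvectors. For Hermitian [A] and real [a], the adjoint of such a
    row is a column eigenvector. *)
Lemma eigenvalue_hermE A (a : R) : A \is hermsymmx -> eigenvalue A a%:C ->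
  exists2 v : 'cV[R[i]]_n, A *m v = a%:C *: v & v != 0.
Proof.
move=> /hermsymmx_adj Ah /eigenvalueP[v vA v0].
exists (v ^t*)%sesqui; last first.
  by apply: contra v0 => /eqP v0; rewrite -[v]trmxCK v0 trmx0 map_mx0.
rewrite -{1}Ah -map_mxM -trmx_mul vA linearZ /= map_mxZ; congr (_ *: _).
exact: conjC_real_complex.
Qed.

(** Since P (P v) = P v, every vector P v is an eigenvector for [a]. *)
Lemma eigenprojection_mull A a P :
  is_eigenprojection A a P -> A *m P = a%:C *: P.
Proof.
case=> _ PP AP; apply: mulmx_cV_inj => v.
by rewrite -mulmxA -scalemxAl; apply/AP; rewrite mulmxA PP.
Qed.

Lemma eigenprojection_mulr A a P : A \is hermsymmx ->
  is_eigenprojection A a P -> P *m A = a%:C *: P.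
Proof.
move=> /hermsymmx_adj Ah AP; have [/hermsymmx_adj Ph _ _] := AP.
rewrite -{1}Ph -{1}Ah -map_mxM -trmx_mul (eigenprojection_mull AP).
by rewrite linearZ /= map_mxZ Ph /= conjC_real_complex.
Qed.

Variables (A : 'M[R[i]]_n) (N : nat) (h : 'I_N -> R) (Pi : 'I_N -> 'M[R[i]]_n).
Hypotheses (A_herm : A \is hermsymmx) (A_spec : is_spectral_decomposition A h Pi).

(** The product Pi_y A Pi_z equals both h_y Pi_y Pi_z and h_z Pi_y Pi_z, and h_y differs from
    h_z. *)
Lemma spectral_orthogonal y z : y != z -> Pi y *m Pi z = 0.
Proof.
case: A_spec => hI _ /[dup] /(_ y) Py /(_ z) Pz _ yz.
have := erefl (Pi y *m A *m Pi z).
rewrite {1}(eigenprojection_mulr A_herm Py) -mulmxA (eigenprojection_mull Pz).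
rewrite -scalemxAl -scalemxAr => /eqP; rewrite -subr_eq0 -scalerBl scaler_eq0.
by rewrite subr_eq0 (inj_eq (@complexI _)) (inj_eq hI) (negPf yz) => /eqP.
Qed.

(** The complement Q of the sum is killed by every Pi_z, hence by [A]. A nonzero Q v would be an
    eigenvector for 0, so 0 would be some h_z and Pi_z would fix Q v, although Pi_z Q = 0. *)
Lemma spectral_sum : \sum_y Pi y = 1%:M.
Proof.
case: A_spec => hI hev hP AE; set Q := 1%:M - \sum_y Pi y.
have PQ z : Pi z *m Q = 0.
  rewrite mulmxBr mulmx1 mulmx_sumr (bigD1 z) //= big1 ?addr0.
    by have [_ -> _] := hP z; rewrite subrr.
  by move=> y yz; rewrite spectral_orthogonal // eq_sym.
have AQ : A *m Q = 0.
  rewrite AE mulmx_suml big1 // => y _.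
  by rewrite -scalemxAl PQ scaler0.
apply/esym/eqP; rewrite -subr_eq0 -/Q; apply/eqP/mulmx_cV_inj => v.
rewrite mul0mx; apply/eqP; apply: contraT => Qv0.
have : eigenvalue A 0.
  apply/eigenvalueP; exists ((Q *m v) ^t*)%sesqui.
    by rewrite -{1}(hermsymmx_adj A_herm) -map_mxM -trmx_mul mulmxA AQ mul0mx trmx0
       map_mx0 scale0r.
  by apply: contra Qv0 => /eqP Qv0; rewrite -[Q *m v]trmxCK Qv0 trmx0 map_mx0.
move=> /hev[z hz]; have [_ _ /(_ (Q *m v)) [_]] := hP z.
by rewrite -hz !mulmxA AQ mul0mx scale0r PQ mul0mx => /(_ erefl) Qv;
  rewrite -Qv eqxx in Qv0.
Qed.

(** Tr(A^2) is the sum of h_y^2 rank(Pi_y), and each rank is at least 1 because every h_y has an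
    eigenvector. Strict inequality comes from degenerate eigenvalues. *)
Lemma spectral_trace_sqr :
  \sum_y h y ^+ 2 <= complex.Re (\tr (A *m A)).
Proof.
case: A_spec => hI hev hP AE.
have -> : A *m A = \sum_y ((h y) ^+ 2)%:C *: Pi y.
  rewrite {1}AE mulmx_suml; apply: eq_bigr => y _.
  by rewrite -scalemxAl (eigenprojection_mulr A_herm (hP y)) scalerA -rmorphM.
rewrite Re_trace_sum; apply: ler_sum => y _.
have [_ PP PyE] := hP y.
rewrite /= mxtraceZ (mxtrace_idempotent PP).
rewrite -(rmorph_nat (real_complex R)) -rmorphM /= ler_peMr ?sqr_ge0 //.
rewrite ler1n lt0n mxrank_eq0.
have [|v Av v0] := @eigenvalue_hermE A (h y) A_herm.
  by apply/hev; exists y.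
apply: contra v0 => /eqP P0; apply/eqP.
by move/PyE : Av; rewrite P0 mul0mx.
Qed.

End Spectral.

Section ObservableMean.
Variables (R : realType) (n D : nat).
Variables (G : 'I_D -> n.-tuple pauli) (V : 'I_D -> 'M[R[i]]_(2 ^ n)).
Hypothesis V_unitary : forall d, V d \is unitarymx.
Variables (H : 'M[R[i]]_(2 ^ n)) (N : nat) (h : 'I_N -> R).
Variable Pi : 'I_N -> 'M[R[i]]_(2 ^ n).
Hypotheses (H_herm : H \is hermsymmx) (H_spec : is_spectral_decomposition H h Pi).

Lemma observable_mean_spectral theta :
  observable_mean G V H theta =
  \sum_y h y * observable_mean G V (Pi y) theta.
Proof.
have [_ _ _ HE] := H_spec; rewrite /observable_mean {1}HE mulmx_suml.
rewrite Re_trace_sum; apply: eq_bigr => y _.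
rewrite /= -scalemxAl mxtraceZ; case: (\tr _) => a b /=.
by rewrite mul0r subr0.
Qed.

Lemma sum_observable_mean theta :
  \sum_y observable_mean G V (Pi y) theta = 1.
Proof.
rewrite /observable_mean -Re_trace_sum -mulmx_suml.
by rewrite (spectral_sum H_herm H_spec) mul1mx trace_density.
Qed.

End ObservableMean.

(** * Dependence of the loss on the parameters *)

(** Isolates one factor of a noncommutative product: [A] and [B] are the products to the left and
    right of [d], the same for all families that differ from [F] only at [d]. *)
Lemma big_split_at (S : pzRingType) (I : finType) (d : I) (F : I -> S) :
  exists A B : S, forall F' : I -> S, (forall i, i != d -> F' i = F i) ->
  \prod_i F' i = A * F' d * B.
Proof.
have := index_enum_uniq I.
move: (index_enum _) (mem_index_enum d) => r dr.
case/splitPr: dr => r1 r2; rewrite cat_uniq /= => /and3P[_ hn /andP[dr2 _]].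
have dr1 : d \notin r1 by move: hn; rewrite negb_or => /andP[].
exists (\prod_(i <- r1) F i), (\prod_(i <- r2) F i) => F' FF'.
have sh (r' : seq I) : d \notin r' ->
    \prod_(i <- r') F' i = \prod_(i <- r') F i.
  move=> dr'; apply: eq_big_seq => i ir'; apply: FF'.
  by apply: contraNneq dr' => <-.
by rewrite big_cat big_cons /= (sh _ dr1) (sh _ dr2) mulrA.
Qed.

Lemma ReD (R : rcfType) (x y : R[i]) :
  complex.Re (x + y) = complex.Re x + complex.Re y.
Proof. by case: x y => [? ?] [? ?]. Qed.

(** This is the real part of <v2|H|v1>, written as a trace so that its diagonal at [ket theta]
    unfolds to [observable_mean]. *)
Definition sesqui_form (R : realType) n (H : 'M[R[i]]_n) (v1 v2 : 'cV[R[i]]_n) : R :=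
  complex.Re (\tr (H *m (v1 *m (v2 ^t*)%sesqui))).

(** The form is bilinear over the reals: [c] and [s] are real, so conjugation leaves them
    unchanged. *)
Lemma sesqui_form_comb (R : realType) n (H : 'M[R[i]]_n) (c s : R)
    (u w p : 'cV[R[i]]_n) : p = c%:C *: u + s%:C *: w ->
  sesqui_form H p p = c ^+ 2 * sesqui_form H u u +
    c * s * (sesqui_form H u w + sesqui_form H w u) + s ^+ 2 * sesqui_form H w w.
Proof.
move=> ->; pose m := sesqui_form H.
have mDl v1 v2 v : m (v1 + v2) v = m v1 v + m v2 v.
  rewrite /m /sesqui_form mulmxDl mulmxDr mxtraceD; exact: ReD.
have mDr v v1 v2 : m v (v1 + v2) = m v v1 + m v v2.
  have adjD : ((v1 + v2) ^t*)%sesqui = (v1 ^t*)%sesqui + (v2 ^t*)%sesqui.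
    by apply/matrixP => i j; rewrite !mxE rmorphD.
  rewrite /m /sesqui_form adjD 2!mulmxDr mxtraceD; exact: ReD.
have mZl a v1 v2 : m (a%:C *: v1) v2 = a * m v1 v2.
  rewrite /m /sesqui_form -scalemxAl -scalemxAr mxtraceZ.
  by case: (\tr _) => x y /=; rewrite mul0r subr0.
have mZr a v1 v2 : m v1 (a%:C *: v2) = a * m v1 v2.
  rewrite /m /sesqui_form linearZ /= map_mxZ /= conjC_real_complex -!scalemxAr mxtraceZ.
  by case: (\tr _) => x y /=; rewrite mul0r subr0.
rewrite -/m mDl 2!mDr 4!mZl 4!mZr.
move: (m _ _) (m _ _) (m _ _) (m _ _) => a1 a2 a3 a4; ring.
Qed.

Section ParameterShift.
Variables (R : realType) (n D : nat).
Variables (G : 'I_D -> n.-tuple pauli) (V : 'I_D -> 'M[R[i]]_(2 ^ n)).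
Variables (theta : 'rV[R]_D) (d : 'I_D).

Lemma circuit_shift : exists A B : 'M[R[i]]_(2 ^ n), forall x : R,
  circuit G V (theta + x *: delta_mx 0 d) =
  A *m rotation (G d) (theta 0 d + x) *m B.
Proof.
have [A [B AB]] := big_split_at d (fun i => rotation (G i) (theta 0 i) *m V i).
exists A, (V d *m B) => x; rewrite mulmxA -[in RHS](mulmxA A).
(* The angle is read as a coordinate of the shifted point, so that the whole product is an instance
   of the family varying only at [d]. *)
have -> : theta 0 d + x = (theta + x *: delta_mx 0 d) 0 d.
  by rewrite !mxE !eqxx mulr1.
apply: AB => i /negPf id.
by rewrite !mxE id andbF mulr0 addr0.
Qed.

(** The state is c u + s w with c, s the cosine and sine of t/2, so the mean is a quadratic form in
    (c, s). The double-angle formulas make it affine in cos t and sin t. *)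
Lemma observable_mean_shift (H : 'M[R[i]]_(2 ^ n)) : exists a b c : R,
  forall x : R, observable_mean G V H (theta + x *: delta_mx 0 d) =
  a + b * cos (theta 0 d + x) + c * sin (theta 0 d + x).
Proof.
have [A [B AB]] := circuit_shift.
(* [u] and [w] are the images of |0> under the identity part and the [-i G] part of the rotation. *)
pose u := A *m B *m ket0 R n.
pose w : 'cV[R[i]]_(2 ^ n) := (- 'i%C) *: (A *m pauli_string R (G d) *m B *m ket0 R n).
pose m := sesqui_form H.
(* These come from c^2 = (1 + cos t)/2, s^2 = (1 - cos t)/2 and c s = sin t / 2. *)
exists ((m u u + m w w) / 2), ((m u u - m w w) / 2), ((m u w + m w u) / 2) => x.
rewrite /observable_mean /density /ket AB rotationE.
set t := theta 0 d + x; set c := cos (t / 2); set s := sin (t / 2).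
have kE : A *m (c%:C *: 1%:M + - ('i%C * s%:C) *: pauli_string R (G d)) *m B *m ket0 R n
    = c%:C *: u + s%:C *: w.
  rewrite mulmxDr !mulmxDl -!scalemxAr -!scalemxAl mulmx1 scalerA.
  by rewrite mulrN [s%:C * _]mulrC.
rewrite -[LHS]/(sesqui_form H _ _) (sesqui_form_comb H kE) -/m.
have -> : cos t = c ^+ 2 - s ^+ 2 by rewrite /c /s -cosD -splitr.
have -> : sin t = s * c + c * s by rewrite /c /s -sinD -splitr.
have cs : c ^+ 2 + s ^+ 2 = 1 by exact: cos2Dsin2.
have {cs} -> : c ^+ 2 = 1 - s ^+ 2 by rewrite -cs addrK.
move: (m _ _) (m _ _) (m _ _) (m _ _) => a1 a2 a3 a4.
by field.
Qed.

(** For a + b cos + c sin, half the difference between the values at +pi/2 and -pi/2 is -b sin + c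
    cos, which is the derivative. *)
Lemma parameter_shift (H : 'M[R[i]]_(2 ^ n)) :
  gradient (observable_mean G V H) theta 0 d =
  2^-1 * (observable_mean G V H (shift_param theta true d) -
          observable_mean G V H (shift_param theta false d)).
Proof.
have [a [b [c abc]]] := observable_mean_shift H.
rewrite mxE /shift_param -scaleNr !abc.
pose g x : R := a + b * cos (theta 0 d + x) + c * sin (theta 0 d + x).
(* The difference quotients coincide pointwise once [theta] itself is written as the shift by 0. *)
have -> : 'D_(delta_mx 0 d) (observable_mean G V H) theta = 'D_1 g 0.
  apply: (congr1 (fun F : R -> R => lim (F @ 0^'))); apply/funext => h /=.
  rewrite [h *: _ + _]addrC abc -[in X in _ - X](addr0 theta).
  rewrite -(scale0r (delta_mx 0 d)) abc.
  by rewrite /g !addr0 /GRing.scale /= mulr1.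
have -> : 'D_1 g 0 = - b * sin (theta 0 d) + c * cos (theta 0 d).
  suff : is_derive (0 : R) (1 : R) g (- b * sin (theta 0 d) + c * cos (theta 0 d)).
    by move=> dg; rewrite derive_val.
  have dshift : is_derive (0 : R) (1 : R) (cst (theta 0 d) + id) 1.
    by rewrite -[X in is_derive _ _ _ X]add0r; apply: is_deriveD.
  have shift0 : (cst (theta 0 d) + id) 0 = theta 0 d by exact: addr0.
  have dcos : is_derive (0 : R) (1 : R) (cos \o (cst (theta 0 d) + id))
      (- sin (theta 0 d)).
    by rewrite -[X in is_derive _ _ _ X]mulr1 -{2}shift0; exact: is_derive1_comp.
  have dsin : is_derive (0 : R) (1 : R) (sin \o (cst (theta 0 d) + id))
      (cos (theta 0 d)).
    by rewrite -[X in is_derive _ _ _ X]mulr1 -{2}shift0; exact: is_derive1_comp.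
  have := is_deriveD (is_deriveD (is_derive_cst a (0 : R) (1 : R))
    (is_deriveZ b dcos)) (is_deriveZ c dsin).
  by rewrite add0r /GRing.scale /= mulrN -mulNr.
rewrite cosDpihalf sinDpihalf cosBpihalf sinBpihalf.
by move: (sin _) (cos _) => x y; field.
Qed.

End ParameterShift.

(** * Continuity and periodicity of the means, and attainment of the maximum [nu] *)

Section Continuity.
Variables (X : topologicalType) (R : realType).
Implicit Types (f g : X -> R[i]).

(* [R[i]] itself carries no topology, only its alias [R[i]^o] does. *)
Definition complex_continuous f :=
  continuous (fun x => complex.Re (f x)) /\ continuous (fun x => complex.Im (f x)).

Lemma complex_continuous_cst (c : R[i]) : complex_continuous (fun=> c).
Proof. by split=> x; exact: cvg_cst. Qed.

Lemma complex_continuousD f g : complex_continuous f -> complex_continuous g ->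
  complex_continuous (fun x => f x + g x).
Proof.
move=> [fr fi] [gr gi]; split=> x.
  rewrite (_ : (fun _ => _) = (fun x => complex.Re (f x) + complex.Re (g x))).
    by apply: cvgD; [exact: fr|exact: gr].
  by apply/funext => y; case: (f y) (g y) => [? ?] [? ?].
rewrite (_ : (fun _ => _) = (fun x => complex.Im (f x) + complex.Im (g x))).
  by apply: cvgD; [exact: fi|exact: gi].
by apply/funext => y; case: (f y) (g y) => [? ?] [? ?].
Qed.

Lemma complex_continuousM f g : complex_continuous f -> complex_continuous g ->
  complex_continuous (fun x => f x * g x).
Proof.
move=> [fr fi] [gr gi]; split=> x.
  rewrite (_ : (fun _ => _) = (fun x => complex.Re (f x) * complex.Re (g x)
                                - complex.Im (f x) * complex.Im (g x))).
    by apply: cvgB; apply: cvgM; [exact: fr|exact: gr|exact: fi|exact: gi].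
  by apply/funext => y; case: (f y) (g y) => [? ?] [? ?].
rewrite (_ : (fun _ => _) = (fun x => complex.Re (f x) * complex.Im (g x)
                                + complex.Im (f x) * complex.Re (g x))).
  by apply: cvgD; apply: cvgM; [exact: fr|exact: gi|exact: fi|exact: gr].
by apply/funext => y; case: (f y) (g y) => [? ?] [? ?].
Qed.

Lemma complex_continuous_sum (I : Type) (r : seq I) (F : I -> X -> R[i]) :
  (forall i, complex_continuous (F i)) ->
  complex_continuous (fun x => \sum_(i <- r) F i x).
Proof.
move=> Fc; elim: r => [|i r IH].
  under [X in complex_continuous X]eq_fun do rewrite big_nil.
  exact: complex_continuous_cst.
under [X in complex_continuous X]eq_fun do rewrite big_cons.
exact: complex_continuousD.
Qed.

Lemma complex_continuous_conj f : complex_continuous f ->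
  complex_continuous (fun x => Num.conj (f x)).
Proof.
move=> [fr fi]; split=> x.
  rewrite (_ : (fun _ => _) = (fun x => complex.Re (f x))); first exact: fr.
  by apply/funext => y; case: (f y) => [? ?].
rewrite (_ : (fun _ => _) = (fun x => - complex.Im (f x))).
  by apply: cvgN; exact: fi.
by apply/funext => y; case: (f y) => [? ?].
Qed.

Lemma complex_continuous_real (f : X -> R) : continuous f ->
  complex_continuous (fun x => (f x)%:C).
Proof. by move=> fc; split=> //= x; exact: cvg_cst. Qed.

Definition mx_continuous m n (A : X -> 'M[R[i]]_(m, n)) :=
  forall i j, complex_continuous (fun x => A x i j).

Lemma mx_continuous_cst m n (A : 'M[R[i]]_(m, n)) : mx_continuous (fun=> A).
Proof. by move=> i j; exact: complex_continuous_cst. Qed.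

Lemma mx_continuousM m n p (A : X -> 'M[R[i]]_(m, n)) (B : X -> 'M[R[i]]_(n, p)) :
  mx_continuous A -> mx_continuous B -> mx_continuous (fun x => A x *m B x).
Proof.
move=> Ac Bc i j; under [X in complex_continuous X]eq_fun do rewrite mxE.
by apply: complex_continuous_sum => k; exact: complex_continuousM.
Qed.

Lemma mx_continuous_adj m n (A : X -> 'M[R[i]]_(m, n)) :
  mx_continuous A -> mx_continuous (fun x => ((A x) ^t*)%sesqui).
Proof.
move=> Ac i j; under [X in complex_continuous X]eq_fun do rewrite !mxE.
exact: complex_continuous_conj.
Qed.

Lemma mx_continuous_prod (I : Type) (r : seq I) n (F : I -> X -> 'M[R[i]]_n) :
  (forall i, mx_continuous (F i)) ->
  mx_continuous (fun x => \prod_(i <- r) F i x).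
Proof.
move=> Fc; elim: r => [|i r IH].
  under [X in mx_continuous X]eq_fun do rewrite big_nil.
  exact: mx_continuous_cst.
under [X in mx_continuous X]eq_fun do rewrite big_cons.
exact: mx_continuousM.
Qed.

End Continuity.

Section ObservableMeanContinuity.
Variables (R : realType) (n D : nat).
Variables (G : 'I_D -> n.-tuple pauli) (V : 'I_D -> 'M[R[i]]_(2 ^ n)).
Variable H : 'M[R[i]]_(2 ^ n).

(** The closed form of the rotations makes every entry of the circuit a polynomial in cosines and
    sines of half angles, so continuity of the exponential series is never invoked. *)
Lemma observable_mean_continuous : continuous (observable_mean G V H).
Proof.
have Uc : mx_continuous (circuit G V).
  apply: mx_continuous_prod => d; apply: mx_continuousM; last exact: mx_continuous_cst.
  move=> i j; under [X in complex_continuous X]eq_fun do rewrite rotationE !mxE.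
  have tc : continuous (fun theta : 'rV[R]_D => theta 0 d / 2).
    move=> theta; have := @coord_continuous R 1 D 0 d theta.
    by apply: (@cvgMr_tmp R _ (nbhs theta) _ (fun theta : 'rV[R]_D => theta 0 d)).
  apply: complex_continuousD; apply: complex_continuousM;
    try exact: complex_continuous_cst.
    apply: complex_continuous_real => theta.
    exact: (continuous_comp (tc theta) (@continuous_cos R _)).
  under [X in complex_continuous X]eq_fun do rewrite -mulNr.
  apply: complex_continuousM; first exact: complex_continuous_cst.
  apply: complex_continuous_real => theta.
  exact: (continuous_comp (tc theta) (@continuous_sin R _)).
have kc : mx_continuous (ket G V).
  by apply: mx_continuousM => //; exact: mx_continuous_cst.
have Hc : mx_continuous (fun theta => H *m density G V theta).
  apply: mx_continuousM; first exact: mx_continuous_cst.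
  by apply: mx_continuousM => //; exact: mx_continuous_adj.
by have [] := complex_continuous_sum (index_enum _) (fun i => Hc i i).
Qed.

(** A rotation depends on its angle t only through cos(t/2) and sin(t/2), which have period 4 pi;
    this brings any parameter into a compact box. *)
Lemma observable_mean_periodic (theta : 'rV[R]_D) :
  exists2 theta' : 'rV[R]_D, (forall d, theta' 0 d \in `[- (2 * pi), 2 * pi]) &
    observable_mean G V H theta' = observable_mean G V H theta.
Proof.
(* The witness is 2 acos(cos(t/2)), which has the right cosine; its sign is chosen to be that of
   sin(t/2). *)
have halfangle (t : R) : exists2 t' : R, t' \in `[- (2 * pi), 2 * pi] &
    cos (t' / 2) = cos (t / 2) /\ sin (t' / 2) = sin (t / 2).
  set c := cos (t / 2); have cb : -1 <= c <= 1 by rewrite cos_geN1 cos_le1.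
  have [a0 api] : 0 <= acos c /\ acos c <= pi by rewrite acos_ge0 ?acos_lepi.
  have ca : cos (acos c) = c by rewrite acosK.
  have sa : sin (acos c) = `|sin (t / 2)|.
    by rewrite sin_acos // -sin2cos2 sqrtr_sqr.
  have [s0|s0] := leP 0 (sin (t / 2)).
    exists (acos c * 2); first by rewrite in_itv /=; apply/andP; split; lra.
    by rewrite mulfK ?pnatr_eq0 // ca sa ger0_norm.
  exists (- acos c * 2); first by rewrite in_itv /=; apply/andP; split; lra.
  by rewrite mulfK ?pnatr_eq0 // cosN sinN ca sa ltr0_norm // opprK.
have [t' t'I t'E] : exists2 t' : 'I_D -> R, forall d, t' d \in `[- (2 * pi), 2 * pi] &
    forall d, cos (t' d / 2) = cos (theta 0 d / 2) /\ sin (t' d / 2) = sin (theta 0 d / 2).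
  have /choice[t' t'P] : forall d, exists t', t' \in `[- (2 * pi), 2 * pi] /\
      (cos (t' / 2) = cos (theta 0 d / 2) /\ sin (t' / 2) = sin (theta 0 d / 2)).
    by move=> d; have [t' ? ?] := halfangle (theta 0 d); exists t'.
  by exists t' => d; have [] := t'P d.
exists (\row_d t' d) => [d|]; first by rewrite mxE.
rewrite /observable_mean /density /ket.
suff -> : circuit G V (\row_d t' d) = circuit G V theta by [].
apply: eq_bigr => d _; rewrite !rotationE mxE.
by have [-> ->] := t'E d.
Qed.

End ObservableMeanContinuity.

(** For each outcome the extreme value theorem gives a maximum on the box, global by periodicity;
    the best of the finitely many outcomes is then selected, [y0] ensuring that there is one. *)
Lemma observable_mean_variance_max (R : realType) (n D N : nat)
    (G : 'I_D -> n.-tuple pauli) (V : 'I_D -> 'M[R[i]]_(2 ^ n))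
    (Pi : 'I_N -> 'M[R[i]]_(2 ^ n)) (y0 : 'I_N) :
  let p y theta := observable_mean G V (Pi y) theta in
  exists nu : R, is_maximum [set p y theta * (1 - p y theta) |
    theta in [set: 'rV[R]_D] & y in [set: 'I_N]] nu.
Proof.
move=> p; pose f y theta := p y theta * (1 - p y theta).
pose K := [set v : 'rV[R]_D | forall d, `[- (2 * pi), 2 * pi]%classic (v ord0 d)].
have Kc : compact K.
  apply: (@rV_compact _ _ (fun=> `[- (2 * pi), 2 * pi]%classic)) => _.
  exact: segment_compact.
have K0 : K !=set0.
  exists 0 => d /=; rewrite mxE in_itv /= oppr_le0 andbb.
  by rewrite mulr_ge0 // pi_ge0.
have max1 y : exists theta, forall theta', f y theta' <= f y theta.
  have fc : continuous (f y).
    move=> theta; have pc := @observable_mean_continuous R n D G V (Pi y) theta.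
    exact: (cvgM pc (cvgB (cvg_cst _) pc)).
  have [c _ cmax] := compact_EVT_max K0 Kc (continuous_subspaceT fc).
  exists c => theta'.
  have [t tI pt] := observable_mean_periodic G V (Pi y) theta'.
  by rewrite /f /p -pt; apply: cmax; rewrite inE => d; exact: tI.
have /choice[t tmax] := max1.
have [y1 _ y1max] := arg_maxP (fun y => f y (t y)) (isT : xpredT y0).
exists (f y1 (t y1)); split; first by exists (t y1) => //; exists y1.
move=> _ [theta _ [y _ <-]]; apply: (le_trans (tmax y theta)).
exact: y1max.
Qed.

(** * Variance of a finite distribution *)

Lemma finite_variance_le (R : realFieldType) (N : nat) (h p : 'I_N -> R) (nu : R) :
  (forall y, 0 <= p y) -> \sum_y p y = 1 ->
  (forall y, p y * (1 - p y) <= nu) ->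
  \sum_y h y ^+ 2 * p y - (\sum_y h y * p y) ^+ 2 <= nu * N%:R * \sum_y h y ^+ 2.
Proof.
move=> p0 p1 pnu.
(* Both sides are written as double sums over (y, z), the bound in symmetrized form, and are then
   compared term by term. *)
have -> : nu * N%:R * (\sum_y h y ^+ 2) =
    \sum_y \sum_z nu * (h y ^+ 2 + h z ^+ 2) / 2.
  under [RHS]eq_bigr do rewrite -mulr_suml -mulr_sumr big_split /= sumr_const card_ord.
  rewrite -mulr_suml -mulr_sumr big_split /= sumr_const card_ord sumrMnl.
  by set S := \sum_y h y ^+ 2; rewrite -[S *+ N]mulr_natl; field.
have -> : \sum_y h y ^+ 2 * p y - (\sum_y h y * p y) ^+ 2 =
    \sum_y \sum_z ((z == y)%:R * (h y ^+ 2 * p y) - h y * p y * (h z * p z)).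
  under [RHS]eq_bigr do rewrite sumrB -mulr_sumr -mulr_suml.
  rewrite sumrB -mulr_suml expr2; congr (_ - _); apply: eq_bigr => y _.
  rewrite (bigD1 y) //= eqxx big1 ?addr0 ?mul1r // => z /negPf ->.
  by [].
apply: ler_sum => y _; apply: ler_sum => z _.
have [->|zy] := eqVneq z y.
  rewrite mul1r (_ : _ - _ = h y ^+ 2 * (p y * (1 - p y))); last by ring.
  rewrite (_ : _ / 2 = h y ^+ 2 * nu); last by field.
  by rewrite ler_wpM2l ?sqr_ge0.
(* Two distinct outcomes have total probability at most 1, so p_y p_z is bounded by p_y (1 - p_y),
   hence by [nu]. *)
have pz : p z <= 1 - p y.
  rewrite lerBrDr -p1 (bigD1 y) //= (bigD1 z) //=.
  by rewrite [p z + p y]addrC addrA lerDl sumr_ge0.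
have ppnu : p y * p z <= nu.
  by apply: le_trans (pnu y); rewrite ler_wpM2l.
have pp0 : 0 <= p y * p z by rewrite mulr_ge0.
(* The sum of this inequality and the next is twice the off-diagonal estimate -h_y h_z p_y p_z <= nu
   (h_y^2 + h_z^2)/2. *)
have : (p y * p z) * ((h y + h z) ^+ 2) >= 0 by rewrite mulr_ge0 ?sqr_ge0.
have : (nu - p y * p z) * (h y ^+ 2 + h z ^+ 2) >= 0.
  by rewrite mulr_ge0 ?subr_ge0 ?addr_ge0 ?sqr_ge0.
rewrite mul0r; move: (p y) (p z) (h y) (h z) => a b c e; nra.
Qed.

(** * Almost surely finitely valued random variables *)

Section FinitelyValued.
Context (disp : measure_display) (T : measurableType disp) (R : realType).
Variable P : probability T R.
Implicit Types X Y : T -> R.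

(* Almost sure finiteness of the range is what the law of a measurement outcome
   provides; it makes every expectation below a finite sum. *)
Definition finitely_valued X :=
  measurable_fun setT X /\ exists s : seq R, \forall w \ae P, X w \in s.

(** Integrability and the value of the integral pass along almost everywhere equality from a finite
    combination of indicators. *)
Lemma ae_simple_expectation (I : Type) (r : seq I) (c : I -> R)
    (A : I -> set T) X :
  measurable_fun setT X -> (forall i, measurable (A i)) ->
  (\forall w \ae P, X w = \sum_(i <- r) c i * \1_(A i) w) ->
  P.-integrable setT (EFin \o X) /\
  expectation P X = (\sum_(i <- r) c i * fine (P (A i)))%:E.
Proof.
move=> mX mA XE.
pose S w := \sum_(i <- r) c i * \1_(A i) w.
have iA i : P.-integrable setT (fun w => (c i)%:E * (\1_(A i) w)%:E)%E.
  by apply: integrableZl => //; exact: integrable_indic.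
have SE : (EFin \o S) = (fun w => \sum_(i <- r) (c i)%:E * (\1_(A i) w)%:E)%E.
  by apply/funext => w; rewrite /= /S -sumEFin; apply: eq_bigr => i _; rewrite EFinM.
have iS : P.-integrable setT (EFin \o S).
  by rewrite SE; apply: integrable_sum.
have XS : ae_eq P setT (EFin \o X) (EFin \o S).
  by apply: filterS XE => w XSw _; rewrite /= XSw.
have /measurable_EFinP mX' := mX.
have mS' := measurable_int _ iS.
split.
  apply/integrableP; split => //.
  rewrite (ae_eq_integral (abse \o (EFin \o S))) //.
  - by case/integrableP: iS.
  - exact: measurableT_comp.
  - exact: measurableT_comp.
  - by apply: filterS XE => w XSw _; rewrite /= XSw.
rewrite unlock (ae_eq_integral (EFin \o S)) // SE integral_sum //.
rewrite -sumEFin; apply: eq_bigr => i _.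
rewrite integralZl //; last exact: integrable_indic.
by rewrite integral_indic // setIT EFinM fineK // fin_num_measure.
Qed.

Lemma measurable_preimage1 X a : measurable_fun setT X -> measurable (X @^-1` [set a]).
Proof. by move=> mX; rewrite -[X in measurable X]setTI; exact: mX. Qed.

(** Almost surely f(X) is the sum of f(a) times the indicator of X = a; as [s] has no repetition,
    exactly one term survives. *)
Lemma finite_expectation X (s : seq R) (f : R -> R) :
  measurable_fun setT X -> uniq s -> (\forall w \ae P, X w \in s) ->
  measurable_fun setT (f \o X) ->
  P.-integrable setT (EFin \o (f \o X)) /\
  expectation P (f \o X) = (\sum_(a <- s) f a * fine (P (X @^-1` [set a])))%:E.
Proof.
move=> mX us Xs mf; apply: ae_simple_expectation => //.
  by move=> a; exact: measurable_preimage1.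
apply: filterS Xs => w Xw; rewrite (bigD1_seq (X w)) //= big1 ?addr0.
  by rewrite indicE mem_set // mulr1.
by move=> a aX; rewrite indicE memNset ?mulr0 //= => Xa; rewrite Xa eqxx in aX.
Qed.

Lemma finitely_valued_integrable X :
  finitely_valued X -> P.-integrable setT (EFin \o X).
Proof.
move=> [mX [s Xs]]; have [] := @finite_expectation X (undup s) id mX (undup_uniq s) => //.
by apply: filterS Xs => w; rewrite mem_undup.
Qed.

Lemma finitely_valued_op (op : R -> R -> R) X Y :
  finitely_valued X -> finitely_valued Y ->
  measurable_fun setT (fun w => op (X w) (Y w)) ->
  finitely_valued (fun w => op (X w) (Y w)).
Proof.
move=> [_ [s Xs]] [_ [t Yt]] mop; split=> //.
exists [seq op a b | a <- s, b <- t].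
by apply: filterS2 Xs Yt => w Xw Yw; exact: allpairs_f.
Qed.

Lemma finitely_valued_cst a : finitely_valued (fun=> a).
Proof. by split; [exact: measurable_cst|exists [:: a]; apply: aeW => w; rewrite inE]. Qed.

Lemma finitely_valuedD X Y : finitely_valued X -> finitely_valued Y ->
  finitely_valued (fun w => X w + Y w).
Proof.
move=> fX fY; apply: finitely_valued_op => //.
by apply: measurable_funD; [case: fX|case: fY].
Qed.

Lemma finitely_valuedB X Y : finitely_valued X -> finitely_valued Y ->
  finitely_valued (fun w => X w - Y w).
Proof.
move=> fX fY; apply: (@finitely_valued_op (fun a b => a - b)) => //.
by apply: measurable_funB; [case: fX|case: fY].
Qed.

Lemma finitely_valuedM X Y : finitely_valued X -> finitely_valued Y ->
  finitely_valued (fun w => X w * Y w).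
Proof.
move=> fX fY; apply: finitely_valued_op => //.
by apply: measurable_funM; [case: fX|case: fY].
Qed.

Lemma finitely_valued_sum (I : Type) (r : seq I) (F : I -> T -> R) :
  (forall i, finitely_valued (F i)) ->
  finitely_valued (fun w => \sum_(i <- r) F i w).
Proof.
move=> fF; elim: r => [|i r IH].
  under [X in finitely_valued X]eq_fun do rewrite big_nil; exact: finitely_valued_cst.
under [X in finitely_valued X]eq_fun do rewrite big_cons; exact: finitely_valuedD.
Qed.

(* Junk outside the integrable functions, where the expectation may be infinite. *)
Definition mean X : R := fine (expectation P X).

Lemma expectation_mean X : finitely_valued X -> expectation P X = (mean X)%:E.
Proof.
move=> /finitely_valued_integrable iX; rewrite /mean fineK //.
by rewrite unlock; apply: integrable_fin_num.
Qed.

Lemma mean_cst a : mean (fun=> a) = a.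
Proof. by rewrite /mean (expectation_cst P a). Qed.

Lemma meanD X Y : finitely_valued X -> finitely_valued Y ->
  mean (fun w => X w + Y w) = mean X + mean Y.
Proof.
move=> fX fY; rewrite /mean expectationD; last 2 first.
  exact/Lfun1_integrable/finitely_valued_integrable.
  exact/Lfun1_integrable/finitely_valued_integrable.
by rewrite !expectation_mean.
Qed.

Lemma meanZ a X : finitely_valued X -> mean (fun w => a * X w) = a * mean X.
Proof.
move=> fX; rewrite (_ : (fun _ => _) = (a \o* X)).
  rewrite /mean expectationZl ?expectation_mean //.
  exact/Lfun1_integrable/finitely_valued_integrable.
by apply/funext => w /=; rewrite mulrC.
Qed.

Lemma mean_sum (I : Type) (r : seq I) (F : I -> T -> R) :
  (forall i, finitely_valued (F i)) ->
  mean (fun w => \sum_(i <- r) F i w) = \sum_(i <- r) mean (F i).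
Proof.
move=> fF; elim: r => [|i r IH].
  rewrite big_nil -[RHS](mean_cst 0); congr (mean _).
  by apply/funext => w; rewrite big_nil.
rewrite big_cons -IH -meanD //; last exact: finitely_valued_sum.
by congr (mean _); apply/funext => w; rewrite big_cons.
Qed.

(** Almost surely X Y is a combination of indicators of the events X = a, Y = b. Independence
    factors their probabilities, and the double sum splits into a product. *)
Lemma mean_prod X Y : finitely_valued X -> finitely_valued Y ->
  (forall A B, measurable A -> measurable B ->
     P (X @^-1` A `&` Y @^-1` B) = (P (X @^-1` A) * P (Y @^-1` B))%E) ->
  mean (fun w => X w * Y w) = mean X * mean Y.
Proof.
move=> fX fY indep; have [mX [s Xs]] := fX; have [mY [t Yt]] := fY.
have Xu : \forall w \ae P, X w \in undup s by apply: filterS Xs => w; rewrite mem_undup.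
have Yu : \forall w \ae P, Y w \in undup t by apply: filterS Yt => w; rewrite mem_undup.
have [_ /= EX] := @finite_expectation X _ id mX (undup_uniq s) Xu mX.
have [_ /= EY] := @finite_expectation Y _ id mY (undup_uniq t) Yu mY.
pose A (ab : R * R) := X @^-1` [set ab.1] `&` Y @^-1` [set ab.2].
have mA ab : measurable (A ab) by apply: measurableI; exact: measurable_preimage1.
have mXY : measurable_fun setT (fun w => X w * Y w) by exact: measurable_funM.
have [|_] := @ae_simple_expectation _ [seq (a, b) | a <- undup s, b <- undup t]
    (fun ab => ab.1 * ab.2) A _ mXY mA.
  apply: filterS2 Xu Yu => w Xw Yw.
  rewrite big_allpairs (bigD1_seq (X w)) ?undup_uniq //=.
  rewrite (bigD1_seq (Y w)) ?undup_uniq //= !big1 ?addr0.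
  - by rewrite indicE mem_set // mulr1.
  - move=> a aX; rewrite big1 // => b _.
    by rewrite indicE memNset ?mulr0 // => -[/= Xa _]; rewrite Xa eqxx in aX.
  - by move=> b bY; rewrite indicE memNset ?mulr0 // => -[_ /= Yb]; rewrite Yb eqxx in bY.
rewrite /mean => ->; rewrite [expectation P X]EX [expectation P Y]EY /=.
rewrite big_allpairs mulr_suml; apply: eq_bigr => a _.
rewrite mulr_sumr; apply: eq_bigr => b _ /=.
rewrite indep // fineM ?fin_num_measure //; try exact: measurable_preimage1.
by rewrite mulrACA.
Qed.

Lemma mutually_independent_pair (I : finType) (X : I -> T -> R) (i j : I) :
  mutually_independent P X -> i != j ->
  forall A B, measurable A -> measurable B ->
  P (X i @^-1` A `&` X j @^-1` B) = (P (X i @^-1` A) * P (X j @^-1` B))%E.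
Proof.
move=> indep ij A B mA mB.
(* Independence asks for a measurable set at every index; the intersection over {i, j} sees only [A]
   at [i] and [B] at [j]. *)
pose C k := if k == i then A else B.
have mC k : measurable (C k) by rewrite /C; case: ifP.
have Ci : C i = A by rewrite /C eqxx.
have Cj : C j = B by rewrite /C eq_sym (negPf ij).
have := indep [set i; j]%SET C mC.
rewrite big_setU1 ?inE //= big_set1 Ci Cj => <-; congr (P _).
apply/seteqP; split => w /=.
  by move=> [Aw Bw] k /=; rewrite !inE => /orP[] /eqP ->; rewrite /= ?Ci ?Cj.
move=> CX; have := CX i; have := CX j; rewrite /= !inE !eqxx orbT Ci Cj.
by move=> Bw Aw; split; [exact: Aw|exact: Bw].
Qed.

(** * Moments of measurement outcomes and of their averages *)

Lemma outcome_mean (N : nat) (h p : 'I_N -> R) (X : T -> R) :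
  measurable_fun setT X -> injective h ->
  (forall y, P (X @^-1` [set h y]) = (p y)%:E) -> \sum_y p y = 1 ->
  [/\ finitely_valued X, mean X = \sum_y h y * p y &
      mean (fun w => X w * X w) = \sum_y h y ^+ 2 * p y].
Proof.
move=> mX hI Xp p1.
(* The law gives only the probabilities of the fibres over the [h y]. These are disjoint and have
   total mass 1, so the outcome almost surely lies in [codom h]. *)
have Xh : \forall w \ae P, X w \in codom h.
  pose A := X @^-1` [set` codom h].
  have AE : A = \big[setU/set0]_(y < N) (X @^-1` [set h y]).
    rewrite -bigcup_seq; apply/seteqP; split => w /=.
      by move=> /codomP[y Xy]; exists y => //=; rewrite mem_index_enum.
    by move=> [y _ /= Xy]; rewrite /A /= Xy; exact: codom_f.
  have mA : measurable A.
    by rewrite AE; apply: bigsetU_measurable => y _; exact: measurable_preimage1.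
  have PA : P A = 1%E.
    rewrite AE measure_bigsetU_ord; last 2 first.
    - by move=> y; exact: measurable_preimage1.
    - by move=> y z _ _ [w [/= Xy Xz]]; apply: hI; rewrite -Xy -Xz.
    by rewrite (eq_bigr (fun y => (p y)%:E)) => [|y _]; [rewrite sumEFin p1|exact: Xp].
  apply/negligibleP; first exact: measurableC.
  by apply: (etrans (probability_setC P mA)); rewrite PA subee.
have uh : uniq (codom h) by rewrite map_inj_uniq ?enum_uniq.
have mXX : measurable_fun setT (fun w => X w * X w) by exact: measurable_funM.
have fX : finitely_valued X by split => //; exists (codom h).
have [_ /= EX] := @finite_expectation X _ id mX uh Xh mX.
have [_ /= EXX] := @finite_expectation X _ (fun a => a * a) mX uh Xh mXX.
split => //; rewrite /mean.
  rewrite [expectation P X]EX /= /codom /image_mem big_map big_enum.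
  by apply: eq_bigr => y _; rewrite Xp.
rewrite [expectation P _]EXX /= /codom /image_mem big_map big_enum.
by apply: eq_bigr => y _; rewrite Xp expr2.
Qed.

(** The squared sum has m diagonal terms of mean v + mu^2 and m(m - 1) others of mean mu^2; dividing
    m v + m^2 mu^2 by m^2 gives the second moment. *)
Lemma mean_average (m : nat) (X : 'I_m -> T -> R) (mu v : R) :
  (0 < m)%N -> (forall k, finitely_valued (X k)) ->
  (forall k, mean (X k) = mu) ->
  (forall k, mean (fun w => X k w * X k w) = v + mu ^+ 2) ->
  (forall k l, k != l -> mean (fun w => X k w * X l w) = mu ^+ 2) ->
  let S w := (\sum_k X k w) / m%:R in
  [/\ finitely_valued S, mean S = mu & mean (fun w => S w * S w) = v / m%:R + mu ^+ 2].
Proof.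
move=> m0 fX EX EXX EXY S.
have m0' : m%:R != 0 :> R by rewrite pnatr_eq0 -lt0n.
have fsum : finitely_valued (fun w => \sum_k X k w) by exact: finitely_valued_sum.
have SE : S = (fun w => m%:R^-1 * \sum_k X k w).
  by apply/funext => w; rewrite /S mulrC.
have fS : finitely_valued S.
  by rewrite SE; apply: finitely_valuedM => //; exact: finitely_valued_cst.
split=> //.
  rewrite SE meanZ // mean_sum //; under eq_bigr do rewrite EX.
  by rewrite sumr_const card_ord -[mu *+ m]mulr_natl mulKf.
have fXX k l : finitely_valued (fun w => X k w * X l w) by exact: finitely_valuedM.
have -> : (fun w => S w * S w) = (fun w => (m%:R ^+ 2)^-1 * \sum_k \sum_l X k w * X l w).
  apply/funext => w; rewrite SE mulrACA -expr2 exprVn; congr (_ * _).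
  by rewrite mulr_suml; apply: eq_bigr => k _; rewrite mulr_sumr.
have fk k : finitely_valued (fun w => \sum_l X k w * X l w) by exact: finitely_valued_sum.
rewrite meanZ; last exact: finitely_valued_sum.
rewrite mean_sum //.
(* For fixed [k] there is one diagonal term and [m.-1] others; [m0] turns [m.-1 + 1] back into
   [m]. *)
have E2 k : mean (fun w => \sum_l X k w * X l w) = v + m%:R * mu ^+ 2.
  rewrite mean_sum // (bigD1 k) //= EXX -addrA; congr (_ + _).
  rewrite (eq_bigr (fun=> mu ^+ 2)) => [|l lk]; last by rewrite EXY // eq_sym.
  rewrite sumr_const cardC1 card_ord -[X in _ = X * _](_ : m.-1%:R + 1 = _).
    by rewrite mulrDl mul1r mulr_natl addrC.
  by rewrite natr1 prednK.
under eq_bigr do rewrite E2.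
by rewrite sumr_const card_ord -[(v + _) *+ m]mulr_natl; field.
Qed.

(** The covariance vanishes because the mean of X Y is a b, so the variance of (X - Y)/2 is a
    quarter of the sum of the variances. *)
Lemma mean_sqr_half_difference (X Y : T -> R) (a b : R) :
  finitely_valued X -> finitely_valued Y -> mean X = a -> mean Y = b ->
  mean (fun w => X w * Y w) = a * b ->
  mean (fun w => (2^-1 * (X w - Y w) - 2^-1 * (a - b)) ^+ 2) =
  ((mean (fun w => X w * X w) - a ^+ 2) + (mean (fun w => Y w * Y w) - b ^+ 2)) / 4.
Proof.
move=> fX fY EX EY EXY.
have -> : (fun w => (2^-1 * (X w - Y w) - 2^-1 * (a - b)) ^+ 2) =
  (fun w => 4^-1 * (X w * X w) + (4^-1 * (Y w * Y w) + ((- 2^-1) * (X w * Y w) +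
    ((- (2^-1 * (a - b))) * X w + (2^-1 * (a - b) * Y w + 4^-1 * (a - b) ^+ 2))))).
  by apply/funext => w; field.
have fZ c Z : finitely_valued Z -> finitely_valued (fun w => c * Z w).
  by move=> fZ; apply: finitely_valuedM => //; exact: finitely_valued_cst.
have fXX : finitely_valued (fun w => X w * X w) by exact: finitely_valuedM.
have fYY : finitely_valued (fun w => Y w * Y w) by exact: finitely_valuedM.
have fXY : finitely_valued (fun w => X w * Y w) by exact: finitely_valuedM.
have fc c : finitely_valued (fun=> c) := finitely_valued_cst c.
rewrite !meanD;
  do ?[exact: fZ | exact: fc | apply: finitely_valuedD].
rewrite !meanZ // mean_cst EX EY EXY.
by move: (mean _) (mean _) => x y; field.
Qed.

End FinitelyValued.

(** * Unbiasedness and variance of the gradient estimator *)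

Theorem lemma3p1 (R : realType) (n D : nat) (D_gt0 : (0 < D)%N)
    (G : 'I_D -> n.-tuple pauli) (V : 'I_D -> 'M[R[i]]_(2 ^ n))
    (V_unitary : forall d, V d \is unitarymx)
    (H : 'M[R[i]]_(2 ^ n)) (H_herm : H \is hermsymmx)
    (Nh : nat) (h : 'I_Nh -> R) (Pi : 'I_Nh -> 'M[R[i]]_(2 ^ n))
    (H_spec : is_spectral_decomposition H h Pi)
    (thetat : 'rV[R]_D) (Nm : nat) (Nm_gt0 : (0 < Nm)%N)
    (disp : measure_display) (T : measurableType disp) (P : probability T R)
    (M : bool -> 'I_D -> 'I_Nm -> {RV P >-> R})
    (M_law : forall s d m y,
       P (M s d m @^-1` [set h y]) =
       (observable_mean G V (Pi y) (shift_param thetat s d))%:E)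
    (M_indep : forall s d, mutually_independent P (fun m => M s d m))
    (mean_indep : mutually_independent P
       (fun sd : bool * 'I_D => empirical_mean (M sd.1 sd.2))) :
  let p y theta := observable_mean G V (Pi y) theta in
  let g := gradient (observable_mean G V H) thetat in
  let ghat := gradient_estimator M in
  let xi w := ghat w - g in
  (forall d, expectation P (fun w => ghat w 0 d) = (g 0 d)%:E) /\
  exists nu : R,
    [/\ is_maximum [set p y theta * (1 - p y theta) |
                      theta in [set: 'rV[R]_D] & y in [set: 'I_Nh]] nu,
        0 <= nu <= 4^-1,
        vvariance P xi = expectation P (fun w => sqnorm2 (ghat w - g)) &
        (expectation P (fun w => sqnorm2 (ghat w - g)) <=
         (nu * Nh%:R * D%:R * complex.Re (\tr (H ^+ 2)) / (2 * Nm%:R))%:E)%E].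
Proof.
move=> p g ghat xi.
pose L theta := observable_mean G V H theta.
have p_sum theta : \sum_y p y theta = 1.
  exact: (@sum_observable_mean R n D G V V_unitary H Nh h Pi H_herm H_spec).
have L_sum theta : L theta = \sum_y h y * p y theta.
  exact: (@observable_mean_spectral R n D G V H Nh h Pi H_spec).
have [h_inj _ _ _] := H_spec.
pose a s d := L (shift_param thetat s d).
(* [a] and [v] are the mean and the variance of a single outcome of the circuit shifted at [d] with
   sign [s]. *)
pose v s d := \sum_y h y ^+ 2 * p y (shift_param thetat s d) - a s d ^+ 2.
pose S s d := empirical_mean (M s d).
have M_fv s d k : finitely_valued P (M s d k).
  by have [] := outcome_mean (measurable_funPT (M s d k)) h_inj (M_law s d k) (p_sum _).
have M_mean s d k : mean P (M s d k) = a s d.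
  by have [_ -> _] :=
    outcome_mean (measurable_funPT (M s d k)) h_inj (M_law s d k) (p_sum _);
    rewrite /a L_sum.
have M_sqr s d k : mean P (fun w => M s d k w * M s d k w) = v s d + a s d ^+ 2.
  have [_ _ ->] := outcome_mean (measurable_funPT (M s d k)) h_inj (M_law s d k) (p_sum _).
  by rewrite /v subrK.
have S_mean s d : [/\ finitely_valued P (S s d), mean P (S s d) = a s d &
    mean P (fun w => S s d w * S s d w) = v s d / Nm%:R + a s d ^+ 2].
  apply: mean_average => // k l kl.
  rewrite mean_prod // ?M_mean ?expr2 //.
  exact: (mutually_independent_pair (M_indep s d) kl).
have S_fv s d : finitely_valued P (S s d) by case: (S_mean s d).
have gE d : g 0 d = 2^-1 * (a true d - a false d) by exact: parameter_shift.
have ghatE d : (fun w => ghat w 0 d) = (fun w => 2^-1 * (S true d w - S false d w)).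
  by apply/funext => w; rewrite mxE.
have fZ c Z : finitely_valued P Z -> finitely_valued P (fun w => c * Z w).
  by move=> ?; apply: finitely_valuedM => //; exact: finitely_valued_cst.
have ghat_fv d : finitely_valued P (fun w => ghat w 0 d).
  by rewrite ghatE; apply: fZ; exact: finitely_valuedB.
(* Unbiasedness: the averages have the shifted losses as means, and the parameter-shift rule
   identifies their half difference with the derivative. *)
have ghat_mean d : mean P (fun w => ghat w 0 d) = g 0 d.
  rewrite ghatE (_ : (fun _ => _) =
      (fun w => 2^-1 * S true d w + (- 2^-1) * S false d w)).
    rewrite meanD ?meanZ //; try exact: fZ.
    have [_ -> _] := S_mean true d; have [_ -> _] := S_mean false d.
    by rewrite gE mulNr mulrBr.
  by apply/funext => w; rewrite mulNr mulrBr.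
have err_fv d : finitely_valued P (fun w => ghat w 0 d - g 0 d).
  by apply: finitely_valuedB => //; exact: finitely_valued_cst.
have Nm0 : 0 < Nm%:R :> R by rewrite ltr0n.
have err_arith (x y b c : R) :
    (x / Nm%:R + b - b + (y / Nm%:R + c - c)) / 4 = (x + y) / (4 * Nm%:R).
  by field; rewrite lt0r_neq0.
have err_sqr d : mean P (fun w => (ghat w 0 d - g 0 d) ^+ 2) =
    (v true d + v false d) / (4 * Nm%:R).
  rewrite (_ : (fun _ => _) = (fun w =>
    (2^-1 * (S true d w - S false d w) - 2^-1 * (a true d - a false d)) ^+ 2));
    last first.
    by apply/funext => w; rewrite mxE gE.
  rewrite (@mean_sqr_half_difference _ _ _ P _ _ (a true d) (a false d)) //.
  - have [_ _ ->] := S_mean true d; have [_ _ ->] := S_mean false d.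
    exact: err_arith.
  - by case: (S_mean true d).
  - by case: (S_mean false d).
  - rewrite mean_prod //.
      by have [_ -> _] := S_mean true d; have [_ -> _] := S_mean false d.
    (* The cross term is removed by the independence of the two averages taken at opposite shifts of
       the same coordinate. *)
    exact: (mutually_independent_pair (i := (true, d)) (j := (false, d)) mean_indep).
split=> [d|]; first by rewrite expectation_mean // ghat_mean.
(* With no outcome, the probabilities would sum to 0 instead of 1. *)
have y0 : 'I_Nh.
  case: (posnP Nh) => [N0|N_gt0]; last exact: (Ordinal N_gt0).
  exfalso; have /eqP := p_sum 0; rewrite big1 ?(eq_sym 0) ?oner_eq0 // => y _.
  by have := ltn_ord y; rewrite [X in (_ < X)%N]N0 ltn0.
(* Nonnegativity is read off the law: at a shifted point, p is the probability of an event. [Nm_gt0]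
   supplies a measurement to look at. *)
have p_ge0 s d y : 0 <= p y (shift_param thetat s d).
  by rewrite -lee_fin -(M_law s d (Ordinal Nm_gt0) y).
have [nu nu_max] := observable_mean_variance_max G V Pi y0.
have p_le_nu theta y : p y theta * (1 - p y theta) <= nu.
  by apply: (proj2 nu_max); exists theta => //; exists y.
have nu_ge0 : 0 <= nu.
  (* Any shifted point will do, since there 0 <= p <= 1; [D_gt0] supplies a coordinate to shift. *)
  pose th := shift_param thetat true (Ordinal D_gt0).
  apply: le_trans (p_le_nu th y0); rewrite mulr_ge0 ?p_ge0 // subr_ge0.
  by rewrite -(p_sum th) (bigD1 y0) //= lerDl sumr_ge0 // => y _; exact: p_ge0.
exists nu; split => //.
- rewrite nu_ge0 /=; have [[theta _ [y _ <-]] _] := nu_max.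
  (* The upper bound is 1/4 - p (1 - p) = (p - 1/2)^2. *)
  rewrite -subr_ge0 (_ : _ - _ = (p y theta - 2^-1) ^+ 2) ?sqr_ge0 //.
  by rewrite /p; field.
- rewrite /vvariance; congr (expectation P _); apply/funext => w.
  (* By unbiasedness the error is centred, so its variance is its second moment. *)
  suff -> : vmean P xi = 0 by rewrite subr0.
  apply/rowP => d; rewrite !mxE.
  rewrite (_ : (fun _ => _) = (fun w => ghat w 0 d + - g 0 d)).
    rewrite -/(mean P _) meanD ?ghat_mean ?mean_cst ?subrr //.
    exact: finitely_valued_cst.
  by apply/funext => w'; rewrite !mxE.
rewrite (_ : (fun _ => _) = (fun w => \sum_d (ghat w 0 d - g 0 d) ^+ 2)); last first.
  by apply/funext => w; apply: eq_bigr => d _; rewrite !mxE.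
have sq_fv d : finitely_valued P (fun w => (ghat w 0 d - g 0 d) ^+ 2).
  rewrite (_ : (fun _ => _) = (fun w => (ghat w 0 d - g 0 d) * (ghat w 0 d - g 0 d))).
    exact: finitely_valuedM.
  by apply/funext => w; rewrite expr2.
rewrite expectation_mean ?lee_fin; last exact: finitely_valued_sum.
rewrite mean_sum //.
pose B := nu * Nh%:R * complex.Re (\tr (H ^+ 2)).
have v_le s d : v s d <= B.
  rewrite /v /a L_sum; set th := shift_param _ _ _.
  apply: (le_trans (finite_variance_le h (p_ge0 s d) (p_sum th) (p_le_nu th))).
  rewrite ler_wpM2l ?mulr_ge0 //.
  exact: (spectral_trace_sqr H_herm H_spec).
(* Each coordinate contributes two outcome variances, each at most [B], divided by 4 Nm; summing the
   resulting B / (2 Nm) over the coordinates gives the factor [D]. *)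
apply: (@le_trans _ _ (\sum_(d < D) B / (2 * Nm%:R))).
  apply: ler_sum => d _; rewrite err_sqr.
  rewrite (_ : B / _ = (B + B) / (4 * Nm%:R)); last by field; rewrite lt0r_neq0.
  by rewrite ler_wpM2r ?invr_ge0 ?mulr_ge0 ?lerD // ltW.
rewrite sumr_const card_ord -[_ *+ D]mulr_natl /B.
by rewrite le_eqVlt; apply/orP; left; apply/eqP; field; rewrite lt0r_neq0.
Qed.
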